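(* Let $0<q<p$ be real numbers and let $f,g,h\in\mathfrak{A}(p,q)$ have determining functions $A(t)$, $B(t)$ and $C(t)$, respectively. Then: 1. $f*g\in\mathfrak{A}(p,q)$; 2. $f*g=g*f$; 3. $f*g$ has determining function $A(t)B(t)$; 4. $f*(g*h)=(f*g)*h$.
   Context: Polynomials have complex coefficients. Notation: $[n]_{p,q}=\frac{p^n-q^n}{p-q}$; $[0]_{p,q}!=1$ and $[n]_{p,q}!=\prod_{k=1}^n[k]_{p,q}$; $\binom{n}{2}=\frac{n(n-1)}{2}$; $e_{p,q}(z)=\sum_{n=0}^{\infty}\frac{p^{\binom n2}}{[n]_{p,q}!}z^n$; $D_{p,q}f(x)=\frac{f(px)-f(qx)}{(p-q)x}$ for $x\neq 0$, $(D_{p,q}f)(0)=f'(0)$. A polynomial set is a sequence $f=\{f_n(x)\}_{n\ge 0}$ with $f_n(x)$ of exact degree $n$. $\mathfrak{A}(p,q)$ is the class of all $(p,q)$-Appell sets, i.e. polynomial sets with $D_{p,q}f_{n+1}(x)=[n+1]_{p,q}f_n(px)$ for all $n\ge 0$. The determining function of $f\in\mathfrak{A}(p,q)$ is the (unique) formal power series $A(t)$ with $A(t)e_{p,q}(xt)=\sum_{n\ge0}f_n(x)\frac{t^n}{[n]_{p,q}!}$. For polynomial sets $f,g$ with $f_n(x)=\sum_{k=0}^n\alpha(n,k)x^k$, the product $f*g$ is the polynomial set with $n$-th component $(f*g)_n(x)=\sum_{k=0}^n\alpha(n,k)\,p^{-\binom k2}g_k(x)$. *)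

(* Defs.v *)
From HB Require Import structures.
From mathcomp Require Import all_boot all_order all_algebra.
From mathcomp Require Import reals.
From mathcomp Require Import complex ring.
Set Implicit Arguments.
Unset Strict Implicit.
Unset Printing Implicit Defensive.
Import Order.TTheory GRing.Theory Num.Theory.
Local Open Scope ring_scope.
Local Open Scope complex_scope.

Section PQCalculus.
Variable F : fieldType.
Implicit Types (p q x : F) (u : {poly F}) (f g : nat -> {poly F}).

Definition pq_num p q n : F := (p ^+ n - q ^+ n) / (p - q).

Definition pq_fact p q n : F := \prod_(1 <= k < n.+1) pq_num p q k.

(* The value of D_{p,q} u at the point x; on polynomials the derivative at 0 is
   the formal one. *)
Definition pq_deriv p q u x : F :=
  if x == 0 then u^`().[0] else (u.[p * x] - u.[q * x]) / ((p - q) * x).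

Definition polynomial_set f := forall n, size (f n) = n.+1.

Definition pq_appell p q f :=
  polynomial_set f /\
  forall n x, pq_deriv p q (f n.+1) x = pq_num p q n.+1 * (f n).[p * x].

(* A formal power series in t over a ring S is given by its coefficient
   sequence nat -> S; fps_mul is the Cauchy product. *)
Definition fps_mul (S : nzRingType) (A B : nat -> S) : nat -> S :=
  fun n => \sum_(i < n.+1) A i * B (n - i)%N.

Definition pq_exp p q : nat -> F := fun n => p ^+ 'C(n, 2) / pq_fact p q n.

(* A(t) e_{p,q}(x t) = \sum_n f_n(x) t^n / [n]_{p,q}!, as an identity between
   formal power series in t with coefficients in F[x]. *)
Definition determining_function p q f (A : nat -> F) :=
  fps_mul (fun n => (A n)%:P) (fun n => pq_exp p q n *: 'X^n)
    =1 (fun n => (pq_fact p q n)^-1 *: f n).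

Definition pq_prod p f g : nat -> {poly F} :=
  fun n => \sum_(k < n.+1) ((f n)`_k * p ^- 'C(k, 2)) *: g k.

End PQCalculus.

Section DeterminingFunction.
Variables (R : realType) (p q : R).
Hypotheses (q_gt0 : 0 < q) (lt_qp : q < p).
Let P : R[i] := p%:C.
Let Q : R[i] := q%:C.
Let p_gt0 : 0 < p. Proof. exact: lt_trans lt_qp. Qed.

Let PQ_neq0 : P - Q != 0.
Proof.
by rewrite -rmorphB fmorph_eq0 subr_eq0 gt_eqF.
Qed.

Lemma pq_num_neq0 n : pq_num P Q n.+1 != 0.
Proof.
rewrite mulf_neq0 ?invr_eq0 // -!rmorphXn -rmorphB fmorph_eq0 subr_eq0.
by rewrite gt_eqF // ltrXn2r // ?nnegrE ltW.
Qed.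

Lemma pq_factS n : pq_fact P Q n.+1 = pq_fact P Q n * pq_num P Q n.+1.
Proof. by rewrite /pq_fact big_nat_recr. Qed.

Lemma pq_fact_neq0 n : pq_fact P Q n != 0.
Proof.
elim: n => [|n IH]; first by rewrite /pq_fact big_geq ?oner_neq0.
by rewrite pq_factS mulf_neq0 ?pq_num_neq0.
Qed.

Lemma poly_horner_ext (u v : {poly R[i]}) : (forall x, u.[x] = v.[x]) -> u = v.
Proof.
move=> uv; apply/eqP; rewrite -subr_eq0; apply/negPn/negP => nz.
pose s := [seq k%:R : R[i] | k <- iota 0 (size (u - v))].
have us : uniq s by rewrite map_inj_uniq ?iota_uniq //; exact: mulrIn (oner_neq0 _).
have rs : all (root (u - v)) s.
  by apply/allP => x _; rewrite /root !hornerE uv subrr.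
by have := max_poly_roots nz rs us; rewrite size_map size_iota ltnn.
Qed.

Lemma coef_comp_scaleX (a : R[i]) (u : {poly R[i]}) k :
  (u \Po (a *: 'X))`_k = u`_k * a ^+ k.
Proof.
have -> : u \Po (a *: 'X) = \poly_(i < size u) (u`_i * a ^+ i).
  rewrite comp_polyE poly_def; apply: eq_bigr => i _.
  by rewrite exprZn scalerA.
rewrite coef_poly; case: ltnP => // le; by rewrite nth_default ?mul0r.
Qed.

Lemma pq_appell_coef f n k : pq_appell P Q f ->
  pq_num P Q k.+1 * (f n.+1)`_k.+1 = pq_num P Q n.+1 * P ^+ k * (f n)`_k.
Proof.
move=> [_ fA].
have E : (f n.+1 \Po (P *: 'X)) - (f n.+1 \Po (Q *: 'X)) =
    ((P - Q) * pq_num P Q n.+1) *: ((f n \Po (P *: 'X)) * 'X).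
  apply: poly_horner_ext => x.
  rewrite !(hornerD, hornerN, hornerZ, horner_comp, hornerMX, hornerX).
  have [->|x0] := eqVneq x 0; first by rewrite !mulr0 subrr.
  have := fA n x; rewrite /pq_deriv (negPf x0) => /eqP.
  rewrite -(divr1 (_ * _.[_])) eqr_div ?oner_neq0 ?mulf_neq0 // mulr1 => /eqP ->.
  ring.
have := congr1 (fun u : {poly R[i]} => u`_k.+1) E.
rewrite coefB coefZ coefMX /= !coef_comp_scaleX -mulrBr => H.
apply: (mulfI PQ_neq0); rewrite {1}/pq_num mulrA mulrCA divff // mulr1 mulrC H.
by rewrite -!mulrA [(f n)`_k * _]mulrC.
Qed.

Lemma pq_exp0 : pq_exp P Q 0 = 1.
Proof. by rewrite /pq_exp /pq_fact big_geq // bin_small // expr0 divr1. Qed.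

Lemma pq_appell_coefE f n k : pq_appell P Q f ->
  (f (n + k)%N)`_k / pq_fact P Q (n + k) =
  (f n)`_0 / pq_fact P Q n * pq_exp P Q k.
Proof.
move=> fA; elim: k => [|k IH].
  by rewrite addn0 pq_exp0 mulr1.
have -> : pq_exp P Q k.+1 = pq_exp P Q k * (P ^+ k / pq_num P Q k.+1).
  by rewrite /pq_exp pq_factS binS bin1 exprD invfM mulrACA.
rewrite mulrA -IH addnS pq_factS.
have := pq_appell_coef (n + k) k fA.
move/(canRL (mulKf (pq_num_neq0 k))) => ->.
by field; rewrite pq_fact_neq0 !pq_num_neq0.
Qed.

Lemma coef_fps_mul_pq_exp (A : nat -> R[i]) n k :
  (fps_mul (fun n => (A n)%:P) (fun n => pq_exp P Q n *: 'X^n) n)`_k =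
  if (k <= n)%N then A (n - k)%N * pq_exp P Q k else 0.
Proof.
rewrite /fps_mul coef_sum.
case: leqP => [le|lt]; last first.
  rewrite big1 // => i _; rewrite coefCM coefZ coefXn gtn_eqF ?mulr0 //.
  exact: leq_ltn_trans (leq_subr _ _) lt.
have lt : (n - k < n.+1)%N by rewrite ltnS leq_subr.
rewrite (bigD1 (Ordinal lt)) //= big1 => [|i ne].
  by rewrite addr0 coefCM coefZ coefXn subKn // eqxx mulr1.
rewrite coefCM coefZ coefXn; case: eqP => [kE|_]; last by rewrite !mulr0.
by case/eqP: ne; apply: val_inj; rewrite /= kE subKn // -ltnS.
Qed.

(* Justifies speaking of _the_ determining function of a (p,q)-Appell set. *)
Theorem determining_function_exists_unique f : pq_appell P Q f ->
  exists A, determining_function P Q f A /\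
    forall B, determining_function P Q f B -> B =1 A.
Proof.
move=> fA; exists (fun n => (f n)`_0 / pq_fact P Q n); split.
  move=> n; apply/polyP => k; rewrite coef_fps_mul_pq_exp coefZ.
  case: leqP => [le|lt]; last by rewrite nth_default ?mulr0 // fA.1.
  by rewrite -pq_appell_coefE // subnK // mulrC.
move=> B dB n; have := congr1 (fun u : {poly R[i]} => u`_0) (dB n).
by rewrite coef_fps_mul_pq_exp subn0 coefZ pq_exp0 mulr1 mulrC.
Qed.

End DeterminingFunction.

(* Main.v *)
(** A polynomial set with determining function [A] is given by
    [f_n = [n]! (A E)_n], where [E(t) = e_{p,q}(x t)], and it is (p,q)-Appell
    exactly when [A_0 != 0].  In [(f * g)_n] the weights [p^-binom(k,2)] cancel
    those of [E], so that [(f * g)_n = [n]! (A (B E))_n = [n]! ((A B) E)_n].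
    Hence [*] corresponds to the Cauchy product of determining functions,
    which is commutative and associative. *)

Require Import Defs.
From HB Require Import structures.
From mathcomp Require Import all_boot all_order all_algebra.
From mathcomp Require Import reals complex ring.
Set Implicit Arguments.
Unset Strict Implicit.
Unset Printing Implicit Defensive.
Import Order.TTheory GRing.Theory Num.Theory.
Local Open Scope ring_scope.
Local Open Scope complex_scope.

(** The coefficient at [n] involves only indices up to [n], so truncating at any [m > n] is
    harmless. This transfers ring laws from polynomials to series. *)
Lemma fps_mul_coefM (S : nzRingType) (A B : nat -> S) m n : (n < m)%N ->
  fps_mul A B n = (\poly_(i < m) A i * \poly_(i < m) B i)`_n.
Proof.
move=> lt_nm; rewrite coefM; apply: eq_bigr => i _.
rewrite !coef_poly (leq_ltn_trans _ lt_nm) ?(leq_ltn_trans (leq_subr _ _)) //.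
by rewrite -ltnS.
Qed.

Lemma eq_fps_mul (S : nzRingType) (A A' B B' : nat -> S) :
  A =1 A' -> B =1 B' -> fps_mul A B =1 fps_mul A' B'.
Proof. by move=> eA eB n; apply: eq_bigr => i _; rewrite eA eB. Qed.

Lemma fps_mulC (S : comNzRingType) (A B : nat -> S) :
  fps_mul A B =1 fps_mul B A.
Proof. by move=> n; rewrite !(fps_mul_coefM _ _ (ltnSn n)) mulrC. Qed.

Lemma fps_mulA (S : nzRingType) (A B C : nat -> S) :
  fps_mul A (fps_mul B C) =1 fps_mul (fps_mul A B) C.
Proof.
move=> n; set a := \poly_(i < n.+1) A i; set b := \poly_(i < n.+1) B i.
set c := \poly_(i < n.+1) C i.
(* All inner indices are at most [n], so a single truncation at [n.+1] serves both nested
   products. *)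
transitivity (a * (b * c))`_n; last rewrite mulrA.
  rewrite coefM; apply: eq_bigr => i _.
  by rewrite coef_poly ltn_ord (fps_mul_coefM _ _ (_ : _ < n.+1)%N) ?ltnS ?leq_subr.
rewrite coefM; apply: eq_bigr => i _.
by rewrite -(fps_mul_coefM _ _ (ltn_ord i)) coef_poly ltnS leq_subr.
Qed.

Lemma fps_mul_polyC (S : nzRingType) (A B : nat -> S) :
  fps_mul (fun n => (A n)%:P) (fun n => (B n)%:P) =1
  (fun n => (fps_mul A B n)%:P).
Proof.
by move=> n; rewrite rmorph_sum; apply: eq_bigr => i _; rewrite rmorphM.
Qed.

Lemma eq_determining_function (F : fieldType) (p q : F) f (A B : nat -> F) :
  A =1 B -> determining_function p q f A -> determining_function p q f B.
Proof.
move=> AB dA n; rewrite -dA; apply: eq_fps_mul => // k.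
by rewrite AB.
Qed.

(** Since $1/[n]!$ can be cancelled, identities between products of sets reduce to identities
    between their determining functions. *)
Lemma determining_function_inj (R : realType) (p q : R) f g A :
  0 < q -> q < p ->
  determining_function p%:C q%:C f A -> determining_function p%:C q%:C g A ->
  f =1 g.
Proof.
move=> q0 qp df dg n; have := etrans (esym (df n)) (dg n).
by apply: scalerI; rewrite invr_eq0 pq_fact_neq0.
Qed.

Lemma determining_function_coef (R : realType) (p q : R) f A n k :
  0 < q -> q < p -> determining_function p%:C q%:C f A -> (k <= n)%N ->
  (f n)`_k = pq_fact p%:C q%:C n * (A (n - k)%N * pq_exp p%:C q%:C k).
Proof.
move=> q0 qp df le_kn.
have := congr1 (fun u : {poly R[i]} => u`_k) (df n).
rewrite coef_fps_mul_pq_exp le_kn coefZ => ->.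
by rewrite mulVKf ?pq_fact_neq0.
Qed.

Lemma determining_function_nth_default (R : realType) (p q : R) f A n k :
  0 < q -> q < p -> determining_function p%:C q%:C f A -> (n < k)%N ->
  (f n)`_k = 0.
Proof.
move=> q0 qp df lt_nk.
have /eqP := congr1 (fun u : {poly R[i]} => u`_k) (df n).
rewrite coef_fps_mul_pq_exp leqNgt lt_nk coefZ eq_sym mulf_eq0 invr_eq0.
by rewrite (negPf (pq_fact_neq0 q0 qp n)) => /eqP.
Qed.

Lemma pq_exp_neq0 (R : realType) (p q : R) n :
  0 < q -> q < p -> pq_exp p%:C q%:C n != 0.
Proof.
move=> q0 qp; rewrite mulf_neq0 ?invr_eq0 ?pq_fact_neq0 // expf_neq0 //.
by rewrite fmorph_eq0 gt_eqF // (lt_trans q0).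
Qed.

(** $f_0$ is a nonzero constant, and [A 0] is a factor of it. *)
Lemma determining_function_appell_neq0 (R : realType) (p q : R) f A :
  0 < q -> q < p -> pq_appell p%:C q%:C f ->
  determining_function p%:C q%:C f A -> A 0%N != 0.
Proof.
move=> q0 qp [fS _] df.
have : lead_coef (f 0%N) != 0 by rewrite lead_coef_eq0 -size_poly_eq0 fS.
rewrite lead_coefE fS (determining_function_coef q0 qp df) //.
by apply: contraNneq => ->; rewrite mul0r mulr0.
Qed.

Lemma pq_deriv_coef (R : realType) (p q : R) (u v : {poly R[i]}) x :
  q < p -> (forall k, pq_num p%:C q%:C k.+1 * u`_k.+1 = v`_k) ->
  pq_deriv p%:C q%:C u x = v.[x].
Proof.
move=> qp uv; set P := p%:C; set Q := q%:C.
have PQ0 : P - Q != 0 by rewrite -rmorphB fmorph_eq0 subr_eq0 gt_eqF.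
rewrite /pq_deriv; case: eqVneq => [->|x0].
  (* At 0 both sides are the coefficient of $x$ in [u], because $[1]_{p,q} = 1$. *)
  by rewrite !horner_coef0 coef_deriv -uv /pq_num divff // mul1r.
(* Clearing the denominator $(p-q)x$ leaves a polynomial identity, which is compared
   coefficientwise. *)
have E : (u \Po (P *: 'X)) - (u \Po (Q *: 'X)) = (P - Q) *: (v * 'X).
  apply/polyP => k; rewrite coefB coefZ coefMX !coef_comp_scaleX -mulrBr.
  case: k => [|k] /=; first by rewrite subrr !mulr0.
  by rewrite -uv /pq_num mulrA mulrCA divff // mulr1 mulrC.
have := congr1 (fun w : {poly R[i]} => w.[x]) E.
rewrite /= !(hornerD, hornerN, hornerZ, horner_comp, hornerMX, hornerX) => ->.
by field; apply/andP.
Qed.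

(** The coefficient of $x^n$ in $f_n$ is $p^{\binom n2} A_0$, which gives the exact degree. The
    Appell relation comes from $[k+1] e_{k+1} = p^k e_k$ for the coefficients $e_k$ of $e_{p,q}$. *)
Lemma determining_function_appell (R : realType) (p q : R) f A :
  0 < q -> q < p -> determining_function p%:C q%:C f A -> A 0%N != 0 ->
  pq_appell p%:C q%:C f.
Proof.
move=> q0 qp df A0; split=> [n|n x].
  apply/eqP; rewrite eqn_leq; apply/andP; split.
    by apply/leq_sizeP => k /(determining_function_nth_default q0 qp df).
  rewrite ltnNge; apply/negP => /leq_sizeP/(_ n (leqnn n))/eqP; apply/negP.
  rewrite (determining_function_coef q0 qp df) // subnn.
  by rewrite mulf_neq0 ?pq_fact_neq0 // mulf_neq0 ?pq_exp_neq0.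
rewrite (pq_deriv_coef (v := pq_num p%:C q%:C n.+1 *: (f n \Po (p%:C *: 'X)))) //.
  by rewrite !(hornerZ, horner_comp, hornerX).
move=> k; rewrite coefZ coef_comp_scaleX.
have [le_kn|lt_nk] := leqP k n; last first.
  by rewrite !(determining_function_nth_default q0 qp df) // mul0r !mulr0.
rewrite !(determining_function_coef q0 qp df) // subSS /pq_exp !pq_factS.
rewrite binS bin1 exprD.
by field; rewrite pq_fact_neq0 ?pq_num_neq0.
Qed.

Lemma determining_function_prod (R : realType) (p q : R) f g A B :
  0 < q -> q < p ->
  determining_function p%:C q%:C f A -> determining_function p%:C q%:C g B ->
  determining_function p%:C q%:C (pq_prod p%:C f g) (fps_mul A B).
Proof.
move=> q0 qp df dg n; set E := fun n => pq_exp p%:C q%:C n *: 'X^n.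
(* Regroup $(AB)E$ as $A(BE)$ and replace $BE$ by the generating series of [g]. *)
transitivity (fps_mul (fun n => (A n)%:P)
                      (fun n => (pq_fact p%:C q%:C n)^-1 *: g n) n).
  have eE : E =1 E by [].
  rewrite -(eq_fps_mul (fps_mul_polyC A B) eE) -fps_mulA.
  exact: (eq_fps_mul (fun=> erefl) dg).
(* Reversing the Cauchy sum pairs $A_{n-k}$ with $g_k$, the indexing of [pq_prod]. *)
rewrite /fps_mul (reindex_inj rev_ord_inj) /= scaler_sumr.
apply: eq_bigr => k _; have le_kn : (k <= n)%N by rewrite -ltnS.
rewrite (determining_function_coef q0 qp df) // subSS subKn // mul_polyC !scalerA.
congr (_ *: _); rewrite /pq_exp; field.
rewrite !pq_fact_neq0 // expf_neq0 // fmorph_eq0 gt_eqF //.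
exact: lt_trans qp.
Qed.

Theorem theorem9 (R : realType) (p q : R) (q_gt0 : 0 < q) (lt_qp : q < p)
    (f g h : nat -> {poly R[i]}) (A B C : nat -> R[i])
    (f_appell : pq_appell p%:C q%:C f)
    (g_appell : pq_appell p%:C q%:C g)
    (h_appell : pq_appell p%:C q%:C h)
    (detA : determining_function p%:C q%:C f A)
    (detB : determining_function p%:C q%:C g B)
    (detC : determining_function p%:C q%:C h C) :
  [/\ pq_appell p%:C q%:C (pq_prod p%:C f g),
      pq_prod p%:C f g =1 pq_prod p%:C g f,
      determining_function p%:C q%:C (pq_prod p%:C f g) (fps_mul A B)
    & pq_prod p%:C f (pq_prod p%:C g h) =1 pq_prod p%:C (pq_prod p%:C f g) h].
Proof.
have dprod f' g' A' B' := @determining_function_prod R p q f' g' A' B' q_gt0 lt_qp.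
have dAB := dprod _ _ _ _ detA detB.
split=> //.
- apply: (determining_function_appell q_gt0 lt_qp dAB).
  (* The constant coefficient of the product series is $A_0 B_0$. *)
  rewrite /fps_mul big_ord1 mulf_neq0 //.
    exact: determining_function_appell_neq0 f_appell detA.
  exact: determining_function_appell_neq0 g_appell detB.
- apply: (determining_function_inj q_gt0 lt_qp dAB).
  apply: eq_determining_function (dprod _ _ _ _ detB detA).
  exact: fps_mulC.
- apply: determining_function_inj q_gt0 lt_qp _ (dprod _ _ _ _ dAB detC).
  apply: eq_determining_function (dprod _ _ _ _ detA (dprod _ _ _ _ detB detC)).
  exact: fps_mulA.
Qed.
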